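(* The spaces $\mathbb{D}_\oplus$ and $\mathbb{D}_\ominus$ are ideals in $\mathbb{W}$, and $\mathbb{W}=\mathbb{D}_\oplus\times\mathbb{D}_\ominus$ as a direct sum of ideals. Moreover, $\mathbb{D}_\oplus$ is isomorphic to $\mathbb{C}$ and $\mathbb{D}_\ominus$ is isomorphic to $\mathbb{C}$ (as algebras over $\mathbb{R}$). Therefore $\mathbb{W}$ is isomorphic to $\mathbb{C}\times\mathbb{C}$.
   Context: $\mathbb{W}$ is the real algebra $\mathbb{R}^4$ with standard addition $\oplus$ and scalar multiplication, standard basis $\mathbf{1}=(1,0,0,0)$, $\mathbf{i}=(0,1,0,0)$, $\mathbf{j}=(0,0,1,0)$, $\mathbf{k}=(0,0,0,1)$, and multiplication, for $\mathbf{x}=(X_{\mathbf{1}},X_{\mathbf{i}},X_{\mathbf{j}},X_{\mathbf{k}})$ and $\mathbf{y}=(Y_{\mathbf{1}},Y_{\mathbf{i}},Y_{\mathbf{j}},Y_{\mathbf{k}})$, $$\mathbf{x}\otimes\mathbf{y}=(X_{\mathbf{1}}Y_{\mathbf{1}}-X_{\mathbf{i}}Y_{\mathbf{k}}-X_{\mathbf{j}}Y_{\mathbf{j}}-X_{\mathbf{k}}Y_{\mathbf{i}})\,\mathbf{1}\oplus(X_{\mathbf{1}}Y_{\mathbf{i}}+X_{\mathbf{i}}Y_{\mathbf{1}}-X_{\mathbf{j}}Y_{\mathbf{k}}-X_{\mathbf{k}}Y_{\mathbf{j}})\,\mathbf{i}\oplus(X_{\mathbf{1}}Y_{\mathbf{j}}+X_{\mathbf{i}}Y_{\mathbf{i}}+X_{\mathbf{j}}Y_{\mathbf{1}}-X_{\mathbf{k}}Y_{\mathbf{k}})\,\mathbf{j}\oplus(X_{\mathbf{1}}Y_{\mathbf{k}}+X_{\mathbf{i}}Y_{\mathbf{j}}+X_{\mathbf{j}}Y_{\mathbf{i}}+X_{\mathbf{k}}Y_{\mathbf{1}})\,\mathbf{k}.$$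 For $\mathbf{x}\in\mathbb{W}$ put $\mathcal{A}(\mathbf{x})=X_{\mathbf{1}}^2+X_{\mathbf{i}}^2+X_{\mathbf{j}}^2+X_{\mathbf{k}}^2$ and $\mathcal{B}(\mathbf{x})=\sqrt2\,(X_{\mathbf{1}}X_{\mathbf{i}}+X_{\mathbf{i}}X_{\mathbf{j}}+X_{\mathbf{j}}X_{\mathbf{k}}-X_{\mathbf{k}}X_{\mathbf{1}})$, and define $\mathbb{D}_\oplus=\{\mathbf{x}\in\mathbb{W}:\mathcal{A}(\mathbf{x})-\mathcal{B}(\mathbf{x})=0\}$, $\mathbb{D}_\ominus=\{\mathbf{x}\in\mathbb{W}:\mathcal{A}(\mathbf{x})+\mathcal{B}(\mathbf{x})=0\}$. The operations on $\mathbb{D}_\oplus$ and $\mathbb{D}_\ominus$ are those of $\mathbb{W}$ restricted; their identity elements are $\mathbf{1}_{\mathbb{D}_\oplus}=(\frac12,\frac1{\sqrt8},0,-\frac1{\sqrt8})$ and $\mathbf{1}_{\mathbb{D}_\ominus}=(\frac12,-\frac1{\sqrt8},0,\frac1{\sqrt8})$ respectively. *)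

(* Defs.v *)
From HB Require Import structures.
From mathcomp Require Import all_boot all_order all_algebra.
From mathcomp Require Import ring complex reals.

Set Implicit Arguments.
Unset Strict Implicit.
Unset Printing Implicit Defensive.

Import Order.TTheory GRing.Theory Num.Theory.

Local Open Scope ring_scope.

(* Ideals of an algebra.  MathComp's [idealr_closed] is not used because it
   also demands [1 \notin I]. *)
Definition is_ideal (K : nzRingType) (A : lalgType K) (I : {pred A}) : Prop :=
  submod_closed I /\
  (forall a x : A, x \in I -> a * x \in I /\ x * a \in I).

Definition is_direct_sum (K : nzRingType) (A : lalgType K) (I J : {pred A}) :
    Prop :=
  forall x : A, exists! p : A * A, [/\ p.1 \in I, p.2 \in J & x = p.1 + p.2].

(* Isomorphism of unital K-algebras.  To compare with the complex numbers over
   the reals, take B := [Rcomplex R], whose scaling is by R; the bare [R[i]]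
   carries only the scaling by itself. *)
Definition alg_isomorphic (K : nzRingType) (A B : lalgType K) : Prop :=
  exists f : {lrmorphism A -> B}, bijective f.

(* [W R] is R^4 with its own product; coordinates 0, 1, 2, 3 are those on the
   basis vectors 1, i, j, k. *)
Definition W (R : realType) : Type := 'rV[R]_4.

HB.instance Definition _ (R : realType) := GRing.Lmodule.copy (W R) 'rV[R]_4.

Section W.
Variable R : realType.
Implicit Types x y z : W R.

Definition mkW (a b c d : R) : W R := \row_(k < 4) [:: a; b; c; d]`_k.

Definition w1 x : R := x 0 0.
Definition wi x : R := x 0 1.
Definition wj x : R := x 0 2.
Definition wk x : R := x 0 3.

Definition W_one : W R := mkW 1 0 0 0.

Definition W_mul x y : W R :=
  mkW (w1 x * w1 y - wi x * wk y - wj x * wj y - wk x * wi y)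
      (w1 x * wi y + wi x * w1 y - wj x * wk y - wk x * wj y)
      (w1 x * wj y + wi x * wi y + wj x * w1 y - wk x * wk y)
      (w1 x * wk y + wi x * wj y + wj x * wi y + wk x * w1 y).

Lemma w1_mkW a b c d : w1 (mkW a b c d) = a. Proof. by rewrite /w1 mxE. Qed.
Lemma wi_mkW a b c d : wi (mkW a b c d) = b. Proof. by rewrite /wi mxE. Qed.
Lemma wj_mkW a b c d : wj (mkW a b c d) = c. Proof. by rewrite /wj mxE. Qed.
Lemma wk_mkW a b c d : wk (mkW a b c d) = d. Proof. by rewrite /wk mxE. Qed.
Definition w_mkW := (w1_mkW, wi_mkW, wj_mkW, wk_mkW).

Lemma w1D x y : w1 (x + y) = w1 x + w1 y. Proof. by rewrite /w1 mxE. Qed.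
Lemma wiD x y : wi (x + y) = wi x + wi y. Proof. by rewrite /wi mxE. Qed.
Lemma wjD x y : wj (x + y) = wj x + wj y. Proof. by rewrite /wj mxE. Qed.
Lemma wkD x y : wk (x + y) = wk x + wk y. Proof. by rewrite /wk mxE. Qed.
Definition wD := (w1D, wiD, wjD, wkD).

Lemma w1Z a x : w1 (a *: x) = a * w1 x. Proof. by rewrite /w1 mxE. Qed.
Lemma wiZ a x : wi (a *: x) = a * wi x. Proof. by rewrite /wi mxE. Qed.
Lemma wjZ a x : wj (a *: x) = a * wj x. Proof. by rewrite /wj mxE. Qed.
Lemma wkZ a x : wk (a *: x) = a * wk x. Proof. by rewrite /wk mxE. Qed.
Definition wZ := (w1Z, wiZ, wjZ, wkZ).

Lemma w10 : w1 0 = 0. Proof. by rewrite /w1 mxE. Qed.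
Lemma wi0 : wi 0 = 0. Proof. by rewrite /wi mxE. Qed.
Lemma wj0 : wj 0 = 0. Proof. by rewrite /wj mxE. Qed.
Lemma wk0 : wk 0 = 0. Proof. by rewrite /wk mxE. Qed.
Definition w0 := (w10, wi0, wj0, wk0).

Lemma W_eqP x y :
  w1 x = w1 y -> wi x = wi y -> wj x = wj y -> wk x = wk y -> x = y.
Proof.
move=> e1 ei ej ek; apply/rowP; case=> [[|[|[|[|//]]]] lt_k].
- by move: e1; rewrite /w1 (_ : 0 = Ordinal lt_k) //; apply: val_inj.
- by move: ei; rewrite /wi (_ : 1 = Ordinal lt_k) //; apply: val_inj.
- by move: ej; rewrite /wj (_ : 2 = Ordinal lt_k) //; apply: val_inj.
- by move: ek; rewrite /wk (_ : 3 = Ordinal lt_k) //; apply: val_inj.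
Qed.

Lemma W_mulA : associative W_mul.
Proof. by move=> x y z; apply: W_eqP; rewrite !w_mkW; ring. Qed.

Lemma W_mulC : commutative W_mul.
Proof. by move=> x y; apply: W_eqP; rewrite !w_mkW; ring. Qed.

Lemma W_mul1 : left_id W_one W_mul.
Proof. by move=> x; apply: W_eqP; rewrite !w_mkW; ring. Qed.

Lemma W_mulDl : left_distributive W_mul +%R.
Proof. by move=> x y z; apply: W_eqP; rewrite !(w_mkW, wD); ring. Qed.

Lemma W_one_neq0 : W_one != 0.
Proof.
by apply/eqP => /(congr1 w1)/eqP; rewrite w_mkW w0 oner_eq0.
Qed.

HB.instance Definition _ := GRing.Zmodule_isComNzRing.Build (W R)
  W_mulA W_mulC W_mul1 W_mulDl W_one_neq0.

Lemma W_scaleAl (a : R) x y : a *: (x * y) = a *: x * y.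
Proof. by apply: W_eqP; rewrite !(w_mkW, wZ); ring. Qed.

HB.instance Definition _ := GRing.Lmodule_isLalgebra.Build R (W R) W_scaleAl.
HB.instance Definition _ := GRing.Lalgebra_isComAlgebra.Build R (W R).

Definition calA x : R := w1 x ^+ 2 + wi x ^+ 2 + wj x ^+ 2 + wk x ^+ 2.

Definition calB x : R :=
  Num.sqrt 2 * (w1 x * wi x + wi x * wj x + wj x * wk x - wk x * w1 x).

Definition Dplus : {pred W R} := [pred x | calA x - calB x == 0].
Definition Dminus : {pred W R} := [pred x | calA x + calB x == 0].

Definition Dplus_one : W R :=
  mkW (1 / 2) (1 / Num.sqrt 8) 0 (- (1 / Num.sqrt 8)).
Definition Dminus_one : W R :=
  mkW (1 / 2) (- (1 / Num.sqrt 8)) 0 (1 / Num.sqrt 8).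

(* With r = sqrt 2 (resp. r = - sqrt 2), the quadratic form cutting out
   [Dplus] (resp. [Dminus]) is a sum of two squares. *)
Let D (r : R) x : Prop :=
  wi x = r * (w1 x + wj x) / 2 /\ wk x = r * (wj x - w1 x) / 2.

Let D_forms (r : R) x : r ^+ 2 = 2 ->
  (calA x - r * (w1 x * wi x + wi x * wj x + wj x * wk x - wk x * w1 x) == 0)
  <-> D r x.
Proof.
move=> r2.
have -> : calA x - r * (w1 x * wi x + wi x * wj x + wj x * wk x - wk x * w1 x)
  = (wi x - r * (w1 x + wj x) / 2) ^+ 2 + (wk x - r * (wj x - w1 x) / 2) ^+ 2.
  by rewrite /calA; field: r2.
rewrite paddr_eq0 ?sqr_ge0 // !sqrf_eq0 !subr_eq0.
by split=> [/andP[/eqP e1 /eqP e2]|[-> ->]]; rewrite ?eqxx.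
Qed.

Let sqr_sqrt2 : Num.sqrt 2 ^+ 2 = 2 :> R.
Proof. by rewrite sqr_sqrtr. Qed.

Let DplusP x : x \in Dplus <-> D (Num.sqrt 2) x.
Proof. exact: (D_forms x sqr_sqrt2). Qed.

Let DminusP x : x \in Dminus <-> D (- Num.sqrt 2) x.
Proof.
have := @D_forms (- Num.sqrt 2) x; rewrite sqrrN mulNr opprK; exact.
Qed.

Let D_submod (r a : R) x y : D r x -> D r y -> D r (a *: x + y).
Proof.
by case=> xi xk [yi yk]; split; rewrite !(wD, wZ) ?xi ?xk ?yi ?yk; field.
Qed.

Let D0 (r : R) : D r 0.
Proof. by split; rewrite !w0; ring. Qed.

Let D_mul (r : R) x y : r ^+ 2 = 2 -> D r x -> D r (x * y).
Proof.
move=> r2 [xi xk].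
by split; rewrite !w_mkW ?xi ?xk; field: r2.
Qed.

Let sqrt8V : 1 / Num.sqrt 8 = Num.sqrt 2 / 4 :> R.
Proof.
have -> : 8 = 2 ^+ 2 * 2 :> R by ring.
rewrite sqrtrM ?sqr_ge0 // sqrtr_sqr ger0_norm //.
have : Num.sqrt 2 != 0 :> R by rewrite sqrtr_eq0 -ltNge.
by move=> s0; field: sqr_sqrt2.
Qed.

Let D_one (r : R) : D r (mkW (1 / 2) (r / 4) 0 (- (r / 4))).
Proof. by split; rewrite !w_mkW; field. Qed.

Let D_mul1 (r : R) x : r ^+ 2 = 2 -> D r x ->
  mkW (1 / 2) (r / 4) 0 (- (r / 4)) * x = x.
Proof.
by move=> r2 [xi xk]; apply: W_eqP; rewrite !w_mkW ?xi ?xk; field: r2.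
Qed.

Lemma Dplus_submod_closed : submod_closed Dplus.
Proof.
by split=> [|a x y /DplusP ? /DplusP ?]; apply/DplusP;
  [exact: D0|exact: D_submod].
Qed.

Lemma Dminus_submod_closed : submod_closed Dminus.
Proof.
by split=> [|a x y /DminusP ? /DminusP ?]; apply/DminusP;
  [exact: D0|exact: D_submod].
Qed.

Lemma Dplus_mul_closed x y : x \in Dplus -> y \in Dplus -> x * y \in Dplus.
Proof. by move=> /DplusP Dx _; apply/DplusP/D_mul. Qed.

Lemma Dminus_mul_closed x y : x \in Dminus -> y \in Dminus -> x * y \in Dminus.
Proof. by move=> /DminusP Dx _; apply/DminusP/D_mul; rewrite ?sqrrN. Qed.

Lemma Dplus_one_in : Dplus_one \in Dplus.
Proof. by apply/DplusP; rewrite /Dplus_one sqrt8V; apply: D_one. Qed.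

Let Dminus_oneE : Dminus_one =
  mkW (1 / 2) (- Num.sqrt 2 / 4) 0 (- (- Num.sqrt 2 / 4)).
Proof. by rewrite /Dminus_one sqrt8V mulNr opprK. Qed.

Lemma Dminus_one_in : Dminus_one \in Dminus.
Proof. by apply/DminusP; rewrite Dminus_oneE; apply: D_one. Qed.

Lemma Dplus_mul1 x : x \in Dplus -> Dplus_one * x = x.
Proof. by move=> /DplusP Dx; rewrite /Dplus_one sqrt8V; apply: D_mul1. Qed.

Lemma Dminus_mul1 x : x \in Dminus -> Dminus_one * x = x.
Proof.
by move=> /DminusP Dx; rewrite Dminus_oneE; apply: D_mul1; rewrite ?sqrrN.
Qed.

Let mkW_half_neq0 (b c d : R) : mkW (1 / 2) b c d != 0.
Proof.
apply/eqP => /(congr1 w1)/eqP.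
by rewrite w_mkW w0 mul1r invr_eq0 pnatr_eq0.
Qed.

Lemma Dplus_one_neq0 : Dplus_one != 0. Proof. exact: mkW_half_neq0. Qed.
Lemma Dminus_one_neq0 : Dminus_one != 0. Proof. exact: mkW_half_neq0. Qed.

HB.instance Definition _ :=
  GRing.isSubmodClosed.Build R (W R) Dplus Dplus_submod_closed.
HB.instance Definition _ :=
  GRing.isSubmodClosed.Build R (W R) Dminus Dminus_submod_closed.

End W.

(* [Dplus] and [Dminus] as algebras in their own right: the operations are
   restricted from [W R], but the units are [Dplus_one] and [Dminus_one], so
   that these are not unital subalgebras of [W R]. *)
Record Dplus_alg (R : realType) :=
  DplusAlg { Dplus_val : W R; Dplus_valP : Dplus_val \in @Dplus R }.

Record Dminus_alg (R : realType) :=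
  DminusAlg { Dminus_val : W R; Dminus_valP : Dminus_val \in @Dminus R }.

Section Dplus_alg.
Variable R : realType.

HB.instance Definition _ := [isSub for @Dplus_val R].
HB.instance Definition _ := [Choice of Dplus_alg R by <:].
HB.instance Definition _ := [SubChoice_isSubLmodule of Dplus_alg R by <:].

Definition Dplus_alg_one : Dplus_alg R := DplusAlg (@Dplus_one_in R).

Definition Dplus_alg_mul (x y : Dplus_alg R) : Dplus_alg R :=
  DplusAlg (Dplus_mul_closed (Dplus_valP x) (Dplus_valP y)).

Fact Dplus_alg_mulA : associative Dplus_alg_mul.
Proof. by move=> x y z; apply: val_inj; apply: mulrA. Qed.
Fact Dplus_alg_mulC : commutative Dplus_alg_mul.
Proof. by move=> x y; apply: val_inj; apply: mulrC. Qed.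
Fact Dplus_alg_mul1 : left_id Dplus_alg_one Dplus_alg_mul.
Proof. by move=> x; apply/val_inj/Dplus_mul1/Dplus_valP. Qed.
Fact Dplus_alg_mulDl : left_distributive Dplus_alg_mul +%R.
Proof. by move=> x y z; apply: val_inj; apply: mulrDl. Qed.
Fact Dplus_alg_one_neq0 : Dplus_alg_one != 0.
Proof. exact: Dplus_one_neq0. Qed.

HB.instance Definition _ := GRing.Zmodule_isComNzRing.Build (Dplus_alg R)
  Dplus_alg_mulA Dplus_alg_mulC Dplus_alg_mul1 Dplus_alg_mulDl
  Dplus_alg_one_neq0.

Fact Dplus_alg_scaleAl (a : R) (x y : Dplus_alg R) :
  a *: (x * y) = a *: x * y.
Proof. by apply: val_inj; apply: scalerAl. Qed.

HB.instance Definition _ :=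
  GRing.Lmodule_isLalgebra.Build R (Dplus_alg R) Dplus_alg_scaleAl.
HB.instance Definition _ := GRing.Lalgebra_isComAlgebra.Build R (Dplus_alg R).

End Dplus_alg.

Section Dminus_alg.
Variable R : realType.

HB.instance Definition _ := [isSub for @Dminus_val R].
HB.instance Definition _ := [Choice of Dminus_alg R by <:].
HB.instance Definition _ := [SubChoice_isSubLmodule of Dminus_alg R by <:].

Definition Dminus_alg_one : Dminus_alg R := DminusAlg (@Dminus_one_in R).

Definition Dminus_alg_mul (x y : Dminus_alg R) : Dminus_alg R :=
  DminusAlg (Dminus_mul_closed (Dminus_valP x) (Dminus_valP y)).

Fact Dminus_alg_mulA : associative Dminus_alg_mul.
Proof. by move=> x y z; apply: val_inj; apply: mulrA. Qed.
Fact Dminus_alg_mulC : commutative Dminus_alg_mul.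
Proof. by move=> x y; apply: val_inj; apply: mulrC. Qed.
Fact Dminus_alg_mul1 : left_id Dminus_alg_one Dminus_alg_mul.
Proof. by move=> x; apply/val_inj/Dminus_mul1/Dminus_valP. Qed.
Fact Dminus_alg_mulDl : left_distributive Dminus_alg_mul +%R.
Proof. by move=> x y z; apply: val_inj; apply: mulrDl. Qed.
Fact Dminus_alg_one_neq0 : Dminus_alg_one != 0.
Proof. exact: Dminus_one_neq0. Qed.

HB.instance Definition _ := GRing.Zmodule_isComNzRing.Build (Dminus_alg R)
  Dminus_alg_mulA Dminus_alg_mulC Dminus_alg_mul1 Dminus_alg_mulDl
  Dminus_alg_one_neq0.

Fact Dminus_alg_scaleAl (a : R) (x y : Dminus_alg R) :
  a *: (x * y) = a *: x * y.
Proof. by apply: val_inj; apply: scalerAl. Qed.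

HB.instance Definition _ :=
  GRing.Lmodule_isLalgebra.Build R (Dminus_alg R) Dminus_alg_scaleAl.
HB.instance Definition _ := GRing.Lalgebra_isComAlgebra.Build R (Dminus_alg R).

End Dminus_alg.

(* Main.v *)
From HB Require Import structures.
Require Import Defs.
From mathcomp Require Import all_boot all_order all_algebra.
From mathcomp Require Import ring complex reals.

Set Implicit Arguments.
Unset Strict Implicit.
Unset Printing Implicit Defensive.

(* [W R] is R[X]/(X^4 + 1), and X^4 + 1 splits over R as
   (X^2 - sqrt 2 X + 1)(X^2 + sqrt 2 X + 1).  Evaluating X at the primitive
   eighth roots of unity (r + r i) / 2, for r = sqrt 2 and r = - sqrt 2, gives
   two algebra morphisms from [W R] onto the complex numbers, which are jointly
   bijective.  The quadratic forms defining [Dplus] and [Dminus] are the squared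
   moduli of these morphisms, so each of the two spaces is the kernel of one
   morphism and is mapped isomorphically by the other. *)

Import GRing.Theory Num.Theory.
Local Open Scope ring_scope.

(** Lets a function defined inside a proof be bundled as an algebra morphism. *)
Lemma lrmorphism_exists (K : nzRingType) (A B : lalgType K) (f : A -> B) :
  linear f -> monoid_morphism f -> exists g : {lrmorphism A -> B}, g =1 f.
Proof.
move=> f_lin f_mon.
pose l := GRing.isLinear.Build K A B *:%R f f_lin.
pose m := GRing.isMonoidMorphism.Build A B f f_mon.
pose g : {lrmorphism A -> B} := HB.pack f l m.
by exists g.
Qed.

Lemma alg_isomorphic_bij (K : nzRingType) (A B : lalgType K) (f : A -> B) :
  linear f -> monoid_morphism f -> bijective f -> alg_isomorphic A B.
Proof.
move=> f_lin f_mon f_bij; have [g gE] := lrmorphism_exists f_lin f_mon.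
by exists g; apply: (eq_bij f_bij) => x; rewrite gE.
Qed.

Section Evaluation.
Variable R : realType.
Implicit Types (b : bool) (x y : W R) (z : Rcomplex R).

(** The sign bit lets one argument serve both factors; [~~ b] exchanges the two roots. *)
Definition root2 b : R := (-1) ^+ b * Num.sqrt 2.

Lemma root2_sqr b : root2 b ^+ 2 = 2.
Proof. by rewrite exprMn sqrr_sign mul1r sqr_sqrtr. Qed.

Lemma root2N b : root2 (~~ b) = - root2 b.
Proof. by rewrite /root2 signrN mulNr. Qed.

(** With zeta = (r + r i) / 2 and r = [root2 b], the basis vectors i, j, k, that is X, X^2, X^3, go
    to zeta, zeta^2 = i and zeta^3 = (- r + r i) / 2. *)
Definition W_eval b x : Rcomplex R :=
  ((w1 x + root2 b / 2 * (wi x - wk x)) +i*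
   (wj x + root2 b / 2 * (wi x + wk x)))%C.

(** The solution x of the linear system [W_eval b x = z], [W_eval (~~ b) x = 0]. *)
Definition W_lift b z : W R :=
  mkW (complex.Re z / 2) (root2 b / 4 * (complex.Re z + complex.Im z))
      (complex.Im z / 2) (root2 b / 4 * (complex.Im z - complex.Re z)).

Lemma W_eval_linear b : linear (W_eval b).
Proof. by move=> a x y; congr (_ +i* _)%C; rewrite !(wD, wZ) /=; ring. Qed.

HB.instance Definition _ b :=
  GRing.isLinear.Build R (W R) (Rcomplex R) *:%R (W_eval b) (W_eval_linear b).

Lemma W_eval_monoid_morphism b : monoid_morphism (W_eval b).
Proof.
have r2 := root2_sqr b.
split=> [|x y]; congr (_ +i* _)%C; rewrite !w_mkW /=; try by ring.
- by field: r2.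
- by field: r2.
Qed.

HB.instance Definition _ b :=
  GRing.isMonoidMorphism.Build (W R) (Rcomplex R) (W_eval b)
    (W_eval_monoid_morphism b).

Lemma W_liftK b : cancel (W_lift b) (W_eval b).
Proof.
have r2 := root2_sqr b.
by case=> u v; congr (_ +i* _)%C; rewrite !w_mkW /=; field: r2.
Qed.

Lemma W_eval_liftN b z : W_eval (~~ b) (W_lift b z) = 0.
Proof.
have r2 := root2_sqr b.
by case: z => u v; congr (_ +i* _)%C; rewrite root2N !w_mkW /=; field: r2.
Qed.

Lemma W_evalK b x :
  W_lift b (W_eval b x) + W_lift (~~ b) (W_eval (~~ b) x) = x.
Proof.
have r2 := root2_sqr b.
by apply: W_eqP; rewrite !wD !w_mkW /= root2N; field: r2.
Qed.

Lemma W_eval_inj b x y :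
  W_eval b x = W_eval b y -> W_eval (~~ b) x = W_eval (~~ b) y -> x = y.
Proof. by move=> e eN; rewrite -(W_evalK b x) e eN W_evalK. Qed.

(** Indexed so that [W_eval b] is the evaluation that is bijective on [D b], while the opposite one
    vanishes there. *)
Definition D b : {pred W R} := if b then @Dminus R else @Dplus R.

Lemma in_D b x : (x \in D b) = (W_eval (~~ b) x == 0).
Proof.
have -> : (x \in D b) = (calA x - root2 b *
    (w1 x * wi x + wi x * wj x + wj x * wk x - wk x * w1 x) == 0).
  by rewrite /root2; case: b; rewrite /D inE /calB ?expr1 ?mulN1r ?mulNr
    ?opprK ?mul1r.
have r2 := root2_sqr b.
(* Over the reals, both parts of a complex number vanish exactly when the sum of their squares
   does. *)
rewrite eq_complex /= -[in RHS]sqrf_eq0 -[X in _ && X]sqrf_eq0.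
rewrite -paddr_eq0 ?sqr_ge0 //; congr (_ == 0).
by rewrite root2N /calA; field: r2.
Qed.

Lemma D_ideal b : is_ideal (D b).
Proof.
split; first split.
- by rewrite in_D linear0.
- move=> a x y; rewrite !in_D linearP /= => /eqP-> /eqP->.
  by rewrite scaler0 addr0.
- by move=> a x; rewrite !in_D !rmorphM /= => /eqP->; rewrite mulr0 mul0r.
Qed.

Lemma W_lift_in b z : W_lift b z \in D b.
Proof. by rewrite in_D W_eval_liftN. Qed.

Lemma W_evalDK b x : x \in D b -> W_lift b (W_eval b x) = x.
Proof.
rewrite in_D => /eqP xN; apply: (@W_eval_inj b); first exact: W_liftK.
by rewrite W_eval_liftN.
Qed.

(** Each evaluation kills one of the two factors, hence the product, and the evaluations are jointly
    injective. *)
Lemma D_mul_eq0 b x y : x \in D b -> y \in D (~~ b) -> x * y = 0.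
Proof.
rewrite !in_D negbK => /eqP x0 /eqP y0.
by apply: (@W_eval_inj b); rewrite !rmorphM rmorph0 /= ?x0 ?y0 (mul0r, mulr0).
Qed.

(** Each evaluation kills one summand and so determines the other; this gives the uniqueness of the
    decomposition. *)
Lemma D_sum_eval b x y : x \in D b -> y \in D (~~ b) ->
  x = W_lift b (W_eval b (x + y)) /\
  y = W_lift (~~ b) (W_eval (~~ b) (x + y)).
Proof.
move=> xD yD; rewrite !linearD /=.
have /eqP-> : W_eval (~~ b) x == 0 by rewrite -in_D.
have /eqP-> : W_eval b y == 0 by rewrite -{1}[b]negbK -in_D.
by rewrite addr0 add0r !W_evalDK.
Qed.

Lemma D_direct_sum : is_direct_sum (D false) (D true).
Proof.
move=> x; exists (W_lift false (W_eval false x), W_lift true (W_eval true x)).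
split=> [|[y z] [/= yD zD ->]]; first by split; rewrite ?W_lift_in ?W_evalK.
by have [<- <-] := @D_sum_eval false y z yD zD.
Qed.

(** Here [v] and [u] stand for the projection and the constructor of [Dplus_alg] or [Dminus_alg], so
    that both records are treated at once. *)
Lemma D_alg_isomorphic b (A : lalgType R) (v : A -> W R)
    (u : forall x, x \in D b -> A) :
  linear v -> {morph v : p q / p * q} -> injective v ->
  (forall p, v p \in D b) -> (forall x xD, v (u x xD) = x) ->
  alg_isomorphic A (Rcomplex R).
Proof.
move=> v_lin vM v_inj vD uK.
apply: (@alg_isomorphic_bij _ _ _ (W_eval b \o v)).
- by move=> a p q; rewrite /= v_lin linearP.
- split=> [|p q]; last by rewrite /= vM rmorphM.
  (* [v 1] is not the unit of [W R], but it fixes the lift of 1. *)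
  have : v 1 * W_lift b 1 = W_lift b 1.
    by rewrite -(uK _ (W_lift_in b 1)) -vM mul1r.
  by move/(congr1 (W_eval b)); rewrite rmorphM /= W_liftK mulr1.
- exists (fun z => u (W_lift b z) (W_lift_in b z)) => [p|z].
    by apply: v_inj; rewrite uK W_evalDK.
  by rewrite /= uK W_liftK.
Qed.

(** Makes the sum map of [sum_iso] unital. *)
Lemma Dplus_one_add_Dminus_one : Dplus_one R + Dminus_one R = 1.
Proof.
apply: W_eqP; rewrite !wD !w_mkW ?(subrr, addNr, addr0) //.
by rewrite [RHS]splitr.
Qed.

Lemma sum_iso :
  exists f : {lrmorphism (Dplus_alg R * Dminus_alg R)%type -> W R},
    bijective f /\ forall p, f p = Dplus_val p.1 + Dminus_val p.2.
Proof.
pose s (p : Dplus_alg R * Dminus_alg R) := Dplus_val p.1 + Dminus_val p.2.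
have s_lin : linear s.
  by move=> a [p q] [p' q']; rewrite /s /= scalerDr addrACA.
have s_mon : monoid_morphism s.
  split=> [|[[x xD] [y yD]] [[x' xD'] [y' yD']]].
    exact: Dplus_one_add_Dminus_one.
  (* Multiplicativity of the sum map amounts to the vanishing of the cross terms. *)
  have xy' := @D_mul_eq0 false x y' xD yD'.
  have x'y := @D_mul_eq0 false x' y xD' yD.
  by rewrite /s /= mulrDl !mulrDr xy' (mulrC y x') x'y addr0 add0r.
have [f fE] := lrmorphism_exists s_lin s_mon.
exists f; split=> //.
exists (fun x => (DplusAlg (W_lift_in false (W_eval false x)),
                  DminusAlg (W_lift_in true (W_eval true x)))) => [p|x].
  case: p => [[x xD] [y yD]]; rewrite fE /s /=.
  by have [ex ey] := @D_sum_eval false x y xD yD; congr pair; apply: val_inj.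
by rewrite fE /s /= (W_evalK false).
Qed.

(** The Chinese remainder map: the two evaluations are paired, and adding the two lifts inverts the
    pair. *)
Lemma W_isomorphic : alg_isomorphic (W R) (Rcomplex R * Rcomplex R)%type.
Proof.
apply: (@alg_isomorphic_bij _ _ _ (fun x => (W_eval false x, W_eval true x))).
- by move=> a x y; rewrite !linearP.
- by split=> [|x y]; rewrite ?rmorph1 ?rmorphM.
exists (fun p => W_lift false p.1 + W_lift true p.2) => [x|[z t]] /=.
  exact: (W_evalK false).
by rewrite !linearD /= !W_liftK (W_eval_liftN true) (W_eval_liftN false)
  addr0 add0r.
Qed.

End Evaluation.

Theorem theorem9 (R : realType) :
  [/\ is_ideal (@Dplus R) /\ is_ideal (@Dminus R),
      is_direct_sum (@Dplus R) (@Dminus R) /\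
      (exists f : {lrmorphism (Dplus_alg R * Dminus_alg R)%type -> W R},
          bijective f /\
          forall p, f p = Dplus_val p.1 + Dminus_val p.2),
      alg_isomorphic (Dplus_alg R) (Rcomplex R),
      alg_isomorphic (Dminus_alg R) (Rcomplex R) &
      alg_isomorphic (W R) (Rcomplex R * Rcomplex R)%type].
Proof.
split.
- by split; [exact: (D_ideal R false) | exact: (D_ideal R true)].
- by split; [exact: D_direct_sum | exact: sum_iso].
- apply: (@D_alg_isomorphic R false _ (@Dplus_val R) (@DplusAlg R)) => //.
  + exact: val_inj.
  + exact: Dplus_valP.
- apply: (@D_alg_isomorphic R true _ (@Dminus_val R) (@DminusAlg R)) => //.
  + exact: val_inj.
  + exact: Dminus_valP.
- exact: W_isomorphic.
Qed.
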